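(* Let $K$ be a field and let $R$ be a (not necessarily unital) commutative associative $K$-algebra. Then there is an isomorphism of (unital) commutative tridendriform algebras $$U_{CTD}(R)\cong T^q(R),$$ where $U_{CTD}$ is the left adjoint of the forgetful functor from CTD-algebras to commutative algebras and $T^q(R)$ is the quasi-shuffle algebra on $R$.
   Context: All vector spaces and tensor products are over $K$. CTD-algebras. A commutative tridendriform algebra (CTD-algebra) is a vector space $A$ with two bilinear operations $\prec$ and $\cdot$ such that for all $x,y,z\in A$: $x\cdot y=y\cdot x$; $(x\prec y)\prec z=x\prec(y\prec z+z\prec y+y\cdot z)$; $(x\cdot y)\prec z=x\cdot(y\prec z)$; $(x\cdot y)\cdot z=x\cdot(y\cdot z)$. One puts $x*y:=x\prec y+y\prec x+x\cdot y$. A unital CTD-algebra is a vector space $A=K1\oplus\bar A$ where $\bar A$ (the augmentation ideal) is a CTD-algebra, with the operations extended by $1\cdot x=0=x\cdot 1$, $1\prec x=0$, $x\prec 1=x$ for $x\in\bar A$; $1\prec 1$ and $1\cdot 1$ are not defined, and $1$ is the unit for $*$. Morphisms of unital CTD-algebras are linear maps sending $1$ to $1$, augmentation ideal to augmentation ideal, and compatible with $\prec$ and $\cdot$. Universal enveloping CTD-algebra. The forgetful functor from unital CTD-algebras to (not necessarily unital) commutative algebras sends $A=K1\oplus\bar A$ to $(\bar A,\cdot)$, ignoring $\prec$. Its left adjoint is denoted $U_{CTD}$. Explicitly, $U_{CTD}(R)=CTD(R)/\!\sim$, where $CTD(R)$ is the free unital CTD-algebra on the vector space $R$ (every linear map $R\to\bar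 A$ extends uniquely to a morphism $CTD(R)\to A$ of unital CTD-algebras), and $\sim$ identifies, for all $a,b\in R$, the product $ab\in R\subset CTD(R)$ with the dot product $a\cdot b$ computed in $CTD(R)$. Quasi-shuffle algebra. For a (not necessarily unital) commutative associative algebra $(R,\cdot)$, let $T(R)=K1\oplus R\oplus R^{\otimes2}\oplus\cdots$ and $\bar T(R)=R\oplus R^{\otimes 2}\oplus\cdots$; tensors are written as words by concatenation, so $ax$ denotes $a\otimes x$ for $a\in R$, $x\in T(R)$. The operations $\prec$, $\succ$, $\cdot$ are defined inductively, for $a,b\in R$ and $x,y\in T(R)$, by $ax\cdot by=(a\cdot b)(x*y)$, $ax\prec by=a(x*by)$, $ax\succ by=b(ax*y)$, where $x*y:=x\prec y+x\succ y+x\cdot y$, and where, for $x\in\bar T(R)$, $1\cdot x=x\cdot1=0$, $1\prec x=0$, $x\prec1=x$, $1\succ x=x$, $x\succ 1=0$, with $1$ the unit of $*$. $T^q(R)$ is $T(R)$ with these operations; since $R$ is commutative, $x\succ y=y\prec x$, and $T^q(R)$ with $\prec$ and $\cdot$ is a unital CTD-algebra. *)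

(* Defs.v *)
From HB Require Import structures.
From mathcomp Require Import all_boot all_order all_algebra generic_quotient.
From mathcomp Require Import finmap boolp.
From mathcomp.multinomials Require Import monalg.

Set Implicit Arguments.
Unset Strict Implicit.
Unset Printing Implicit Defensive.

Import GRing.Theory.
Local Open Scope ring_scope.
Local Open Scope quotient_scope.

HB.mixin Record Lmodule_isNuComAlg (K : fieldType) R of GRing.Lmodule K R := {
  rmul : R -> R -> R;
  rmul_bilinear : bilinear_for *:%R *:%R rmul;
  rmulA : associative rmul;
  rmulC : commutative rmul
}.
#[short(type="nuComAlgType")]
HB.structure Definition NuComAlg (K : fieldType) :=
  {R of GRing.Lmodule K R & Lmodule_isNuComAlg K R}.
Arguments rmul {K s} : rename.

Definition nucomalg_morphism (K : fieldType) (R S : nuComAlgType K)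
    (f : R -> S) : Prop :=
  linear f /\ forall a b, f (rmul a b) = rmul (f a) (f b).

(* Commutative tridendriform algebras: these are the augmentation ideals of   *)
(* the unital CTD-algebras, which are treated below as [unital A].            *)
HB.mixin Record Lmodule_isCTD (K : fieldType) A of GRing.Lmodule K A := {
  prec : A -> A -> A;
  dot : A -> A -> A;
  prec_bilinear : bilinear_for *:%R *:%R prec;
  dot_bilinear : bilinear_for *:%R *:%R dot;
  dotC : commutative dot;
  precA : forall x y z,
    prec (prec x y) z = prec x (prec y z + prec z y + dot y z);
  dot_prec : forall x y z, prec (dot x y) z = dot x (prec y z);
  dotA : forall x y z, dot (dot x y) z = dot x (dot y z)
}.
#[short(type="ctdType")]
HB.structure Definition CTD (K : fieldType) :=
  {A of GRing.Lmodule K A & Lmodule_isCTD K A}.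
Arguments prec {K s} : rename.
Arguments dot {K s} : rename.

Definition ctd_morphism (K : fieldType) (A B : ctdType K) (f : A -> B) : Prop :=
  [/\ linear f, forall x y, f (prec x y) = prec (f x) (f y)
    & forall x y, f (dot x y) = dot (f x) (f y)].

Section BilinearTheory.
Variable K : fieldType.

Lemma lin0 (U V : lmodType K) (f : U -> V) : linear f -> f 0 = 0.
Proof.
by move=> fl; have := fl (-1) 0 0; rewrite scaler0 addr0 scaleN1r addNr.
Qed.

Lemma linD (U V : lmodType K) (f : U -> V) x y :
  linear f -> f (x + y) = f x + f y.
Proof. by move=> fl; have := fl 1 x y; rewrite !scale1r. Qed.

Lemma linZ (U V : lmodType K) (f : U -> V) c x :
  linear f -> f (c *: x) = c *: f x.
Proof. by move=> fl; have := fl c x 0; rewrite !addr0 (lin0 fl) addr0. Qed.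

Lemma linB (U V : lmodType K) (f : U -> V) x y :
  linear f -> f (x - y) = f x - f y.
Proof. by move=> fl; rewrite linD // -scaleN1r linZ // scaleN1r. Qed.

Lemma lin_comp (U V W : lmodType K) (g : V -> W) (f : U -> V) :
  linear g -> linear f -> linear (g \o f).
Proof. by move=> gl fl c x y; rewrite /= fl gl. Qed.

Lemma lin_add (U V : lmodType K) (f g : U -> V) :
  linear f -> linear g -> linear (fun x => f x + g x).
Proof.
by move=> fl gl c x y; rewrite fl gl scalerDr addrACA.
Qed.

Lemma lin_comb (U V : lmodType K) (f g : U -> V) c :
  linear f -> linear g -> linear (fun x => c *: f x + g x).
Proof.
move=> fl gl d x y.
by rewrite fl gl scalerDr scalerA (mulrC c) -scalerA addrACA -scalerDr.
Qed.

Lemma scale_add3 (V : lmodType K) c (x1 x2 y1 y2 z1 z2 : V) :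
  (c *: x1 + x2) + (c *: y1 + y2) + (c *: z1 + z2) =
  c *: (x1 + y1 + z1) + (x2 + y2 + z2).
Proof. by rewrite !scalerDr (addrACA (c *: x1)) [LHS]addrACA. Qed.

Lemma add7_perm (V : zmodType) (a b c d e f g : V) :
  a + b + c + d + (e + f + g) = a + (b + d + f) + (c + e + g).
Proof.
rewrite -!addrA; congr (_ + (_ + _)); rewrite addrCA; congr (_ + _).
by rewrite (addrCA e f g) addrCA.
Qed.

End BilinearTheory.

(* The forgetful functor, from unital CTD-algebras (given by their            *)
(* augmentation ideal) to commutative algebras: it keeps only the dot product *)
Definition forget (K : fieldType) (A : ctdType K) : Type := A.
HB.instance Definition _ (K : fieldType) (A : ctdType K) :=
  GRing.Lmodule.on (forget A).

Lemma forget_dotA (K : fieldType) (A : ctdType K) :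
  associative (@dot K A : forget A -> forget A -> forget A).
Proof. by move=> x y z; rewrite dotA. Qed.

HB.instance Definition _ (K : fieldType) (A : ctdType K) :=
  Lmodule_isNuComAlg.Build K (forget A)
    (@dot_bilinear K A) (@forget_dotA K A) (@dotC K A).

(* K1 (+) A, where 1 is [uone] and the augmentation ideal is A. *)
Section Unital.
Variables (K : fieldType) (A : ctdType K).

Definition unital : Type := (K * A)%type.
HB.instance Definition _ := GRing.Lmodule.copy unital (K^o * A)%type.

Definition uone : unital := (1, 0).
Definition aug_incl (x : A) : unital := (0, x).
Definition in_aug (x : unital) : Prop := x.1 = 0.

(* [uprec] and [udot] are the bilinear extensions determined by               *)
(* 1 < x = 0, x < 1 = x, 1 . x = x . 1 = 0; the values at (1, 1), where they  *)
(* are undefined, are set to 0, and never used: see [unital_morphism].        *)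
Definition uprec (x y : unital) : unital := (0, y.1 *: x.2 + prec x.2 y.2).
Definition udot (x y : unital) : unital := (0, dot x.2 y.2).

Definition ustar (x y : unital) : unital :=
  (x.1 * y.1,
   x.1 *: y.2 + y.1 *: x.2 + (prec x.2 y.2 + prec y.2 x.2 + dot x.2 y.2)).

End Unital.
Arguments uone {K A}.
Arguments aug_incl {K A}.

Record unital_morphism (K : fieldType) (A B : ctdType K)
    (f : unital A -> unital B) : Prop := UnitalMorphism {
  um_linear : linear f;
  um_one : f uone = uone;
  um_aug : forall x, in_aug x -> in_aug (f x);
  um_prec : forall x y, in_aug x \/ in_aug y ->
    f (uprec x y) = uprec (f x) (f y);
  um_dot : forall x y, in_aug x \/ in_aug y ->
    f (udot x y) = udot (f x) (f y)
}.

Section UnitalTheory.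
Variable K : fieldType.

Section One.
Variable A : ctdType K.

Lemma ustar1x (x : unital A) : ustar uone x = x.
Proof.
case: x => c x; rewrite /ustar /= mul1r scale1r scaler0 addr0.
rewrite (lin0 ((@prec_bilinear _ A).1 x)) (lin0 ((@prec_bilinear _ A).2 x)).
by rewrite (lin0 ((@dot_bilinear _ A).1 x)) !addr0.
Qed.

Lemma ustarC (x y : unital A) : ustar x y = ustar y x.
Proof.
rewrite /ustar mulrC dotC; congr (_, _ + (_ + _)); exact: addrC.
Qed.

Lemma ustar_aug (x y : unital A) : in_aug x -> in_aug y ->
  ustar x y = uprec x y + uprec y x + udot x y.
Proof.
case: x y => [c x] [d y]; rewrite /in_aug /= => -> ->.
rewrite /ustar /uprec /udot /= mulr0 !scale0r !add0r.
by congr (_, _); rewrite /= !addr0.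
Qed.

Lemma unital_split (x : unital A) : x = x.1 *: uone + aug_incl x.2.
Proof.
case: x => c x; congr (_, _) => /=; last by rewrite scaler0 add0r.
by rewrite addr0 /GRing.scale /= mulr1.
Qed.

Lemma aug_incl_linear : linear (@aug_incl K A).
Proof. by move=> c x y; congr (_, _); rewrite /= scaler0 addr0. Qed.
End One.

(* Morphisms of unital CTD-algebras amount to morphisms of CTD-algebras       *)
(* between the augmentation ideals.                                           *)
Lemma unital_morphism_ext (A B : ctdType K) (h : A -> B) :
  ctd_morphism h ->
  unital_morphism (fun x : unital A => (x.1, h x.2) : unital B).
Proof.
case=> hl hp hd; split => //.
- by move=> c [a x] [b y]; congr (_, _); rewrite /= hl.
- by congr (_, _); rewrite /= lin0.
- move=> [c x] [d y] _; congr (_, _).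
  by rewrite /= linD // linZ // hp.
- by move=> [c x] [d y] _; congr (_, _); rewrite /= hd.
Qed.

Lemma unital_morphism_restr (A B : ctdType K) (f : unital A -> unital B) :
  unital_morphism f ->
  ctd_morphism (fun x => (f (aug_incl x)).2)
  /\ forall x, f x = (x.1, (f (aug_incl x.2)).2).
Proof.
case=> fl f1 fa fp fd.
have fE x : f (aug_incl x) = aug_incl (f (aug_incl x)).2.
  have := fa (aug_incl x) (erefl _).
  by case: (f _) => c y; rewrite /in_aug /= => ->.
split; last first.
  move=> x; rewrite {1}(unital_split x) fl f1 fE; congr (_, _) => /=.
    by rewrite addr0 /GRing.scale /= mulr1.
  by rewrite scaler0 add0r.
split=> [c x y|x y|x y].
- by rewrite aug_incl_linear fl.
- have := fp (aug_incl x) (aug_incl y) (or_introl (erefl _)).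
  rewrite /uprec /= scale0r add0r -/(aug_incl (prec x y)) => ->.
  by rewrite /= (fE y) /= scale0r add0r.
- have := fd (aug_incl x) (aug_incl y) (or_introl (erefl _)).
  by rewrite /udot /= -/(aug_incl (dot x y)) => ->.
Qed.

End UnitalTheory.

Section LmodQuotient.
Variables (K : fieldType) (V : lmodType K) (S : submodClosed V).

Definition lsub : {pred V} := S.
Lemma lsub_zmod : zmod_closed lsub.
Proof. exact: GRing.submod_closedB (submodClosedP S). Qed.
HB.instance Definition _ := GRing.isZmodClosed.Build V lsub lsub_zmod.

Definition lquot : Type := Quotient.quot lsub.
HB.instance Definition _ := GRing.Zmodule.on lquot.

Definition lpi (x : V) : lquot := \pi_(Quotient.quot lsub) x.
Definition lrepr (x : lquot) : V := repr (x : Quotient.quot lsub).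

Lemma lreprK : cancel lrepr lpi.
Proof. exact: reprK. Qed.

Lemma lpiE x y : lpi x = lpi y <-> x - y \in S.
Proof.
have := Quotient.idealrBE lsub x y; rewrite [x - y \in lsub]/(x - y \in S) => ->.
by split=> /eqP.
Qed.

Lemma lpiD x y : lpi (x + y) = lpi x + lpi y.
Proof. by rewrite /lpi -[RHS]pi_addr. Qed.

Lemma lrepr_pi x : lrepr (lpi x) - x \in S.
Proof. by apply/lpiE; rewrite lreprK. Qed.

Definition lqscale : K -> lquot -> lquot := locked (fun c x => lpi (c *: lrepr x)).

Lemma lpiZ c x : lpi (c *: x) = lqscale c (lpi x).
Proof. by rewrite /lqscale -lock; apply/esym/lpiE; rewrite -scalerBr rpredZ // lrepr_pi. Qed.

Lemma lqscaleA a b x : lqscale a (lqscale b x) = lqscale (a * b) x.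
Proof. by rewrite -[x]lreprK -!lpiZ scalerA. Qed.
Lemma lqscale1 : left_id 1 lqscale.
Proof. by move=> x; rewrite -[x]lreprK -!lpiZ scale1r. Qed.
Lemma lqscaleDr : right_distributive lqscale +%R.
Proof.
by move=> c x y; rewrite -[x]lreprK -[y]lreprK -lpiD -!lpiZ scalerDr lpiD.
Qed.
Lemma lqscaleDl x : {morph lqscale^~ x : a b / a + b}.
Proof. by move=> a b; rewrite -[x]lreprK -!lpiZ scalerDl lpiD. Qed.

HB.instance Definition _ := GRing.Zmodule_isLmodule.Build K lquot
  lqscaleA lqscale1 lqscaleDr lqscaleDl.

Lemma lpi_linear : linear lpi.
Proof. by move=> c x y; rewrite lpiD lpiZ. Qed.

Lemma lpi_eq0 x : lpi x = 0 <-> x \in S.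
Proof.
have <- : lpi 0 = 0 by exact: (lin0 lpi_linear).
by rewrite -{2}[x]subr0; exact: lpiE.
Qed.

End LmodQuotient.

Section Span.
Variables (K : fieldType) (V : lmodType K) (X : V -> Prop).

Definition lspan : {pred V} := [pred x | `[<
  forall S : V -> Prop, S 0 -> (forall c u v, S u -> S v -> S (c *: u + v)) ->
    (forall u, X u -> S u) -> S x >]].

Lemma lspan_submod : submod_closed lspan.
Proof.
split=> [|c u v]; first by rewrite inE; apply/asboolP => S S0.
rewrite !inE => /asboolP Su /asboolP Sv; apply/asboolP => S S0 Sl SX.
by apply: (Sl); [apply: Su | apply: Sv].
Qed.
HB.instance Definition _ := GRing.isSubmodClosed.Build K V lspan
  (GRing.submod_closed_semi lspan_submod).

Lemma lspan_gen u : X u -> u \in lspan.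
Proof. by move=> Xu; rewrite inE; apply/asboolP => S _ _; apply. Qed.

Lemma lspan_lin0 (W : lmodType K) (f : V -> W) : linear f ->
  (forall u, X u -> f u = 0) -> forall u, u \in lspan -> f u = 0.
Proof.
move=> fl fX u; rewrite inE => /asboolP/(_ (fun u => f u = 0)); apply => //.
  exact: lin0.
by move=> c x y fx fy; rewrite fl fx fy scaler0 addr0.
Qed.

End Span.

(* The free CTD-algebra on a vector space R: terms in the operations, modulo  *)
(* the identities that hold in every CTD-algebra for every linear             *)
(* interpretation of the elements of R.                                       *)
Section Free.
Variables (K : fieldType) (R : lmodType K).

Inductive term : Type :=
  | TGen of R
  | TZero
  | TAdd of term & term
  | TScale of K & term
  | TPrec of term & term
  | TDot of term & term.

HB.instance Definition _ := gen_eqMixin term.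
HB.instance Definition _ := gen_choiceMixin term.

Fixpoint teval (A : ctdType K) (f : R -> A) (t : term) : A :=
  match t with
  | TGen a => f a
  | TZero => 0
  | TAdd t u => teval f t + teval f u
  | TScale c t => c *: teval f t
  | TPrec t u => prec (teval f t) (teval f u)
  | TDot t u => dot (teval f t) (teval f u)
  end.

Definition teq (t u : term) : bool :=
  `[< forall (A : ctdType K) (f : R -> A), linear f -> teval f t = teval f u >].

Lemma teq_equiv : equiv_class_of teq.
Proof.
split=> [t|t u|u t v].
- by apply/asboolP.
- by apply/asboolP/asboolP => tu A f fl; rewrite tu.
- by move=> /asboolP tu /asboolP uv; apply/asboolP => A f fl; rewrite tu ?uv.
Qed.
Canonical teq_equivrel := EquivRelPack teq_equiv.

Definition free_ctd : Type := {eq_quot teq}.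
HB.instance Definition _ := Choice.on free_ctd.

Definition fpi (t : term) : free_ctd := \pi_({eq_quot teq}) t.
Definition frepr (x : free_ctd) : term := repr (x : {eq_quot teq}).

Definition feval (A : ctdType K) (f : R -> A) (x : free_ctd) : A :=
  teval f (frepr x).

Lemma feval_pi (A : ctdType K) (f : R -> A) t :
  linear f -> feval f (fpi t) = teval f t.
Proof.
move=> fl; rewrite /feval /frepr /fpi.
suff : repr (\pi_({eq_quot teq}) t) = t %[mod {eq_quot teq}].
  by move/eqmodP/asboolP; apply.
by rewrite reprK.
Qed.

Lemma feval_ext (x y : free_ctd) :
  (forall (A : ctdType K) (f : R -> A), linear f -> feval f x = feval f y) ->
  x = y.
Proof.
move=> xy; rewrite -[x](@reprK _ {eq_quot teq}) -[y](@reprK _ {eq_quot teq}).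
by apply/eqmodP/asboolP => A f fl; exact: xy.
Qed.

Definition fgen (a : R) : free_ctd := fpi (TGen a).
Definition fzero : free_ctd := fpi TZero.
Definition fadd (x y : free_ctd) := fpi (TAdd (frepr x) (frepr y)).
Definition fscale c (x : free_ctd) := fpi (TScale c (frepr x)).
Definition fopp := fscale (-1).
Definition fprec (x y : free_ctd) := fpi (TPrec (frepr x) (frepr y)).
Definition fdot (x y : free_ctd) := fpi (TDot (frepr x) (frepr y)).

Section Eval.
Variables (A : ctdType K) (f : R -> A).
Hypothesis fl : linear f.
Lemma feval_gen a : feval f (fgen a) = f a. Proof. exact: feval_pi. Qed.
Lemma feval_zero : feval f fzero = 0. Proof. exact: feval_pi. Qed.
Lemma feval_add x y : feval f (fadd x y) = feval f x + feval f y.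
Proof. exact: feval_pi. Qed.
Lemma feval_scale c x : feval f (fscale c x) = c *: feval f x.
Proof. exact: feval_pi. Qed.
Lemma feval_opp x : feval f (fopp x) = - feval f x.
Proof. by rewrite feval_scale scaleN1r. Qed.
Lemma feval_prec x y : feval f (fprec x y) = prec (feval f x) (feval f y).
Proof. exact: feval_pi. Qed.
Lemma feval_dot x y : feval f (fdot x y) = dot (feval f x) (feval f y).
Proof. exact: feval_pi. Qed.
Definition fevalE := (feval_gen, feval_zero, feval_add, feval_opp, feval_scale,
  feval_prec, feval_dot).
End Eval.

Local Ltac ext := move=> *; apply: feval_ext => ? ? ?; rewrite ?fevalE //.

Lemma faddA : associative fadd. Proof. by ext; rewrite addrA. Qed.
Lemma faddC : commutative fadd. Proof. by ext; rewrite addrC. Qed.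
Lemma fadd0 : left_id fzero fadd. Proof. by ext; rewrite add0r. Qed.
Lemma faddN : left_inverse fzero fopp fadd. Proof. by ext; rewrite addNr. Qed.
HB.instance Definition _ := GRing.isZmodule.Build free_ctd faddA faddC fadd0 faddN.

Lemma fscaleA a b x : fscale a (fscale b x) = fscale (a * b) x.
Proof. by ext; rewrite scalerA. Qed.
Lemma fscale1 : left_id 1 fscale. Proof. by ext; rewrite scale1r. Qed.
Lemma fscaleDr : right_distributive fscale +%R.
Proof. by ext; rewrite scalerDr. Qed.
Lemma fscaleDl x : {morph fscale^~ x : a b / a + b}.
Proof. by ext; rewrite scalerDl. Qed.
HB.instance Definition _ := GRing.Zmodule_isLmodule.Build K free_ctd
  fscaleA fscale1 fscaleDr fscaleDl.

Lemma fprec_bilinear : bilinear_for *:%R *:%R fprec.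
Proof.
split=> u c x y /=; ext.
  by rewrite ((@prec_bilinear _ _).1 _).
by rewrite ((@prec_bilinear _ _).2 _).
Qed.
Lemma fdot_bilinear : bilinear_for *:%R *:%R fdot.
Proof.
split=> u c x y /=; ext.
  by rewrite ((@dot_bilinear _ _).1 _).
by rewrite ((@dot_bilinear _ _).2 _).
Qed.
Lemma fdotC : commutative fdot. Proof. by ext; rewrite dotC. Qed.
Lemma fprecA x y z :
  fprec (fprec x y) z = fprec x (fprec y z + fprec z y + fdot y z).
Proof. by ext; rewrite precA. Qed.
Lemma fdot_prec x y z : fprec (fdot x y) z = fdot x (fprec y z).
Proof. by ext; rewrite dot_prec. Qed.
Lemma fdotA x y z : fdot (fdot x y) z = fdot x (fdot y z).
Proof. by ext; rewrite dotA. Qed.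
HB.instance Definition _ := Lmodule_isCTD.Build K free_ctd
  fprec_bilinear fdot_bilinear fdotC fprecA fdot_prec fdotA.

Lemma fgen_linear : linear fgen.
Proof. by move=> c x y; apply: feval_ext => A f fl; rewrite !fevalE // fl. Qed.

Lemma feval_morphism (A : ctdType K) (f : R -> A) :
  linear f -> ctd_morphism (feval f).
Proof.
move=> fl; split=> [c x y|x y|x y]; last exact: feval_dot.
  by rewrite [feval _ _](feval_add fl (fscale c x) y) feval_scale.
exact: feval_prec.
Qed.

Lemma free_ctd_ind (P : free_ctd -> Prop) :
  (forall a, P (fgen a)) -> P 0 -> (forall x y, P x -> P y -> P (x + y)) ->
  (forall c x, P x -> P (c *: x)) ->
  (forall x y, P x -> P y -> P (prec x y)) ->
  (forall x y, P x -> P y -> P (dot x y)) -> forall x, P x.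
Proof.
move=> Pg P0 PD PZ Pp Pd x.
rewrite -[x](@reprK _ {eq_quot teq}) -/(fpi _); move: (repr _) => {x} t.
have pi2 (g : term -> term -> term) (h : free_ctd -> free_ctd -> free_ctd) :
    (forall (A : ctdType K) (f : R -> A) t u, linear f ->
      teval f (g t u) = feval f (h (fpi t) (fpi u))) ->
    forall t u, fpi (g t u) = h (fpi t) (fpi u).
  by move=> gh u v; apply: feval_ext => A f fl; rewrite feval_pi // gh.
elim: t => //.
- move=> t Pt u Pu; rewrite (pi2 TAdd fadd) => [|*]; first exact: PD.
  by rewrite fevalE // !feval_pi.
- move=> c t Pt; have -> : fpi (TScale c t) = c *: fpi t; last exact: PZ.
  by ext; rewrite !feval_pi.
- move=> t Pt u Pu; rewrite (pi2 TPrec fprec) => [|*]; first exact: Pp.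
  by rewrite fevalE // !feval_pi.
- move=> t Pt u Pu; rewrite (pi2 TDot fdot) => [|*]; first exact: Pd.
  by rewrite fevalE // !feval_pi.
Qed.

Lemma free_ctd_morph_ext (A : ctdType K) (f g : free_ctd -> A) :
  ctd_morphism f -> ctd_morphism g -> (forall a, f (fgen a) = g (fgen a)) ->
  f =1 g.
Proof.
move=> [fl fp fd] [gl gp gd] fg; apply: free_ctd_ind => //.
- by rewrite !lin0.
- by move=> x y fx fy; rewrite !linD ?fx ?fy.
- by move=> c x fx; rewrite !linZ ?fx.
- by move=> x y fx fy; rewrite fp gp fx fy.
- by move=> x y fx fy; rewrite fd gd fx fy.
Qed.

End Free.

Theorem free_ctd_universal (K : fieldType) (R : lmodType K) (A : ctdType K)
    (f : R -> A) : linear f ->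
  exists F : unital (free_ctd R) -> unital A,
    [/\ unital_morphism F, forall a, F (aug_incl (fgen a)) = aug_incl (f a)
      & forall G, unital_morphism G ->
          (forall a, G (aug_incl (fgen a)) = aug_incl (f a)) -> G =1 F].
Proof.
move=> fl; exists (fun x => (x.1, feval f x.2)); split.
- exact/unital_morphism_ext/feval_morphism.
- by move=> a; rewrite /= fevalE.
move=> G Gm Gf x; have [gm ->] := unital_morphism_restr Gm; congr (_, _).
apply: (free_ctd_morph_ext gm (feval_morphism fl)) => a.
by rewrite Gf fevalE.
Qed.

(* U_CTD(R) is [unital (env_ctd R)], the quotient of CTD(R) =                 *)
(* [unital (free_ctd R)] by the ideal generated by the elements ab - a . b,   *)
(* which is contained in the augmentation ideal.                              *)
Section Enveloping.
Variables (K : fieldType) (R : nuComAlgType K).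
Let F := free_ctd R.

Record ctd_ideal (A : ctdType K) (I : A -> Prop) : Prop := CtdIdeal {
  ideal0 : I 0;
  idealL : forall c x y, I x -> I y -> I (c *: x + y);
  ideal_precl : forall x y, I x -> I (prec x y);
  ideal_precr : forall x y, I y -> I (prec x y);
  ideal_dot : forall x y, I x -> I (dot x y)
}.

Definition env_ideal : {pred F} := [pred x | `[<
  forall I : F -> Prop, ctd_ideal I ->
    (forall a b : R, I (fgen (rmul a b) - dot (fgen a) (fgen b))) -> I x >]].

Lemma env_ideal_submod : submod_closed env_ideal.
Proof.
split=> [|c u v]; first by rewrite inE; apply/asboolP => I [].
rewrite !inE => /asboolP Iu /asboolP Iv; apply/asboolP => I Ii Ig.
by apply: (idealL Ii); [apply: Iu | apply: Iv].
Qed.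
HB.instance Definition _ := GRing.isSubmodClosed.Build K F env_ideal
  (GRing.submod_closed_semi env_ideal_submod).

Lemma env_ideal_precl x y : x \in env_ideal -> prec x y \in env_ideal.
Proof.
rewrite !inE => /asboolP Ix; apply/asboolP => I Ii Ig.
by apply: (ideal_precl Ii); apply: Ix.
Qed.
Lemma env_ideal_precr x y : y \in env_ideal -> prec x y \in env_ideal.
Proof.
rewrite !inE => /asboolP Ix; apply/asboolP => I Ii Ig.
by apply: (ideal_precr Ii); apply: Ix.
Qed.
Lemma env_ideal_dot x y : x \in env_ideal -> dot x y \in env_ideal.
Proof.
rewrite !inE => /asboolP Ix; apply/asboolP => I Ii Ig.
by apply: (ideal_dot Ii); apply: Ix.
Qed.

Definition env_ctd : Type := lquot env_ideal.
HB.instance Definition _ := GRing.Lmodule.on env_ctd.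

Definition epi (x : F) : env_ctd := lpi env_ideal x.

Definition eprec (x y : env_ctd) : env_ctd := epi (prec (lrepr x) (lrepr y)).
Definition edot (x y : env_ctd) : env_ctd := epi (dot (lrepr x) (lrepr y)).

Lemma epi_linear : linear epi. Proof. exact: lpi_linear. Qed.

Lemma epi_prec x y : epi (prec x y) = eprec (epi x) (epi y).
Proof.
apply/esym/lpiE; set x' := lrepr _; set y' := lrepr _.
have -> : prec x' y' - prec x y = prec (x' - x) y' + prec x (y' - y).
  rewrite (linB _ _ ((@prec_bilinear _ F).1 y')).
  by rewrite (linB _ _ ((@prec_bilinear _ F).2 x)) addrA subrK.
by apply: rpredD; [apply: env_ideal_precl | apply: env_ideal_precr];
  exact: lrepr_pi.
Qed.

Lemma epi_dot x y : epi (dot x y) = edot (epi x) (epi y).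
Proof.
apply/esym/lpiE; set x' := lrepr _; set y' := lrepr _.
have -> : dot x' y' - dot x y = dot (x' - x) y' + dot (y' - y) x.
  rewrite (linB _ _ ((@dot_bilinear _ F).1 y')).
  rewrite (linB _ _ ((@dot_bilinear _ F).1 x)).
  by rewrite (dotC y' x) (dotC y x) addrA subrK.
by apply: rpredD; apply: env_ideal_dot; exact: lrepr_pi.
Qed.

Lemma epi_surj (P : env_ctd -> Prop) : (forall x, P (epi x)) -> forall x, P x.
Proof. by move=> Px x; rewrite -[x]lreprK; exact: Px. Qed.

Lemma eprec_bilinear : bilinear_for *:%R *:%R eprec.
Proof.
split; elim/epi_surj=> u c; elim/epi_surj=> x; elim/epi_surj=> y.
  by rewrite -epi_linear -!epi_prec ((@prec_bilinear _ F).1 u) epi_linear.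
by rewrite -epi_linear -!epi_prec ((@prec_bilinear _ F).2 u) epi_linear.
Qed.
Lemma edot_bilinear : bilinear_for *:%R *:%R edot.
Proof.
split; elim/epi_surj=> u c; elim/epi_surj=> x; elim/epi_surj=> y.
  by rewrite -epi_linear -!epi_dot ((@dot_bilinear _ F).1 u) epi_linear.
by rewrite -epi_linear -!epi_dot ((@dot_bilinear _ F).2 u) epi_linear.
Qed.
Lemma edotC : commutative edot.
Proof. by elim/epi_surj=> x; elim/epi_surj=> y; rewrite -!epi_dot dotC. Qed.
Lemma eprecA x y z :
  eprec (eprec x y) z = eprec x (eprec y z + eprec z y + edot y z).
Proof.
move: x y z; elim/epi_surj=> x; elim/epi_surj=> y; elim/epi_surj=> z.
by rewrite -!epi_prec -epi_dot -!(linD _ _ epi_linear) -epi_prec precA.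
Qed.
Lemma edot_prec x y z : eprec (edot x y) z = edot x (eprec y z).
Proof.
move: x y z; elim/epi_surj=> x; elim/epi_surj=> y; elim/epi_surj=> z.
by rewrite -epi_dot -!epi_prec -epi_dot dot_prec.
Qed.
Lemma edotA x y z : edot (edot x y) z = edot x (edot y z).
Proof.
move: x y z; elim/epi_surj=> x; elim/epi_surj=> y; elim/epi_surj=> z.
by rewrite -!epi_dot dotA.
Qed.
HB.instance Definition _ := Lmodule_isCTD.Build K env_ctd
  eprec_bilinear edot_bilinear edotC eprecA edot_prec edotA.

Lemma epi_morphism : ctd_morphism epi.
Proof. split; [exact: epi_linear | exact: epi_prec | exact: epi_dot]. Qed.

Definition env_unit (a : R) : forget env_ctd := epi (fgen a).

Lemma env_unit_morphism : nucomalg_morphism env_unit.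
Proof.
split=> [c x y|a b]; first by rewrite /env_unit fgen_linear epi_linear.
transitivity (epi (dot (fgen a) (fgen b))); last exact: epi_dot.
by apply/lpiE; rewrite inE; apply/asboolP => I _ Ig; exact: Ig.
Qed.

End Enveloping.

(* Universal property of the unit R -> U_CTD(R): with it, U_CTD is left       *)
(* adjoint to the forgetful functor.                                          *)
Theorem env_ctd_universal (K : fieldType) (R : nuComAlgType K) (A : ctdType K)
    (f : R -> forget A) : nucomalg_morphism f ->
  exists F : unital (env_ctd R) -> unital A,
    [/\ unital_morphism F, forall a, F (aug_incl (env_unit a)) = aug_incl (f a)
      & forall G, unital_morphism G ->
          (forall a, G (aug_incl (env_unit a)) = aug_incl (f a)) -> G =1 F].
Proof.
move=> [fl fM]; pose e : free_ctd R -> A := @feval K R A f.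
have [el ep ed] : ctd_morphism e := feval_morphism fl.
have eI x : x \in @env_ideal K R -> e x = 0.
  rewrite inE => /asboolP/(_ (fun x => e x = 0)); apply.
    split=> [|c u v eu ev|u v eu|u v ev|u v eu].
    - exact: lin0.
    - by rewrite el eu ev scaler0 addr0.
    - by rewrite ep eu (lin0 ((@prec_bilinear _ _).1 _)).
    - by rewrite ep ev (lin0 ((@prec_bilinear _ _).2 _)).
    - by rewrite ed eu (lin0 ((@dot_bilinear _ _).1 _)).
  move=> a b; rewrite linB // ed /e !(fevalE fl).
  by rewrite [f (rmul a b)]fM subrr.
pose h (x : env_ctd R) : A := e (lrepr x).
have hE x : h (epi x) = e x.
  by apply/eqP; rewrite -subr_eq0 /h -(linB _ _ el); apply/eqP/eI/lrepr_pi.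
have hm : ctd_morphism h.
  split; [move=> c|..]; elim/epi_surj=> x; elim/epi_surj=> y.
  - by rewrite -epi_linear !hE el.
  - by rewrite -[prec _ _]epi_prec !hE ep.
  - by rewrite -[dot _ _]epi_dot !hE ed.
exists (fun x => (x.1, h x.2)); split.
- exact: unital_morphism_ext.
- by move=> a; congr (_, _); rewrite /= hE /e (fevalE fl).
move=> G Gm Gf x; have [[gl gp gd] ->] := unital_morphism_restr Gm.
congr (_, _); case: x => _ x /=; move: x; elim/epi_surj=> x; rewrite hE.
apply: (@free_ctd_morph_ext K R A (fun x => (G (aug_incl (epi x))).2) e) => //.
- split=> [c u v|u v|u v].
  + by rewrite epi_linear gl.
  + by rewrite epi_prec gp.
  + by rewrite epi_dot gd.
- by move=> a; rewrite [G _]Gf /e (fevalE fl).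
Qed.

(* The reduced tensor module R (+) R^{(x)2} (+) ... : formal linear           *)
(* combinations of nonempty words in R, modulo linearity in each letter.      *)
(* The pair (a, w) stands for the word a :: w.                                *)
Section Tensor.
Variables (K : fieldType) (R : lmodType K).

Definition nword : Type := (R * seq R)%type.
HB.instance Definition _ := Choice.on nword.

Definition multilinear (V : lmodType K) (f : nword -> V) : Prop :=
  (forall c a b w, f (c *: a + b, w) = c *: f (a, w) + f (b, w)) /\
  (forall h p c a b q, f (h, p ++ (c *: a + b) :: q) =
     c *: f (h, p ++ a :: q) + f (h, p ++ b :: q)).

Definition word1 (w : nword) : {malg K[nword]} := << 1 *g w >>.

Variant mult_rel : {malg K[nword]} -> Prop :=
  | MultHead c a b w :
      mult_rel (word1 (c *: a + b, w) - (c *: word1 (a, w) + word1 (b, w)))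
  | MultTail h p c a b q :
      mult_rel (word1 (h, p ++ (c *: a + b) :: q)
        - (c *: word1 (h, p ++ a :: q) + word1 (h, p ++ b :: q))).

Definition tbar : Type := lquot (lspan mult_rel).
HB.instance Definition _ := GRing.Lmodule.on tbar.

Definition mlift (V : lmodType K) (f : nword -> V) (g : {malg K[nword]}) : V :=
  \sum_(w <- msupp g) g@_w *: f w.

End Tensor.

HB.lock Definition tword (K : fieldType) (R : lmodType K) (w : nword R) :
    tbar R := lpi (lspan (@mult_rel K R)) (word1 w).
Arguments tword {K R} w.

(* The linear map on the tensor module defined by a multilinear function f    *)
(* of words.                                                                  *)
HB.lock Definition tlift (K : fieldType) (R V : lmodType K) (f : nword R -> V)
    (t : tbar R) : V := mlift f (lrepr t).

Section TensorTheory.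
Variables (K : fieldType) (R : lmodType K).
Local Notation nword := (nword R).
Local Notation tbar := (tbar R).
Local Notation mult_rel := (@mult_rel K R).

Section Lift.
Variables (V : lmodType K) (f : nword -> V).

Lemma mliftEw g (d : {fset nword}) : (msupp g `<=` d)%fset ->
  mlift f g = \sum_(w <- d) g@_w *: f w.
Proof.
move=> sub; rewrite /mlift; apply: (big_fset_incl _ sub) => w _ /mcoeff_outdom.
by move=> ->; rewrite scale0r.
Qed.

Lemma mlift_linear : linear (mlift f).
Proof.
move=> c x y; pose d := (msupp x `|` msupp y `|` msupp (c *: x + y))%fset.
have [xd yd zd] : [/\ msupp x `<=` d, msupp y `<=` d
                    & msupp (c *: x + y) `<=` d]%fset.
  by split; apply/fsubsetP => w; rewrite !inE => ->; rewrite ?orbT.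
rewrite (mliftEw xd) (mliftEw yd) (mliftEw zd) scaler_sumr -big_split.
by apply: eq_bigr => w _ /=; rewrite mcoeffD mcoeffZ scalerDl scalerA.
Qed.

Lemma mlift_word w : mlift f (word1 w) = f w.
Proof.
rewrite (@mliftEw _ [fset w]%fset) ?msuppU_le // big_seq_fset1.
by rewrite mcoeffUU scale1r.
Qed.

Hypothesis fm : multilinear f.

Lemma mlift_rel u : u \in lspan mult_rel -> mlift f u = 0.
Proof.
apply: (lspan_lin0 mlift_linear) => {}u [c a b w|h p c a b q];
  rewrite (linB _ _ mlift_linear) mlift_linear !mlift_word.
  by rewrite fm.1 subrr.
by rewrite fm.2 subrr.
Qed.

Lemma tlift_pi g : tlift f (lpi (lspan mult_rel) g) = mlift f g.
Proof.
rewrite unlock; apply/eqP; rewrite -subr_eq0 -(linB _ _ mlift_linear).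
by apply/eqP/mlift_rel/lrepr_pi.
Qed.

Lemma tlift_word w : tlift f (tword w) = f w.
Proof. by rewrite tword.unlock tlift_pi mlift_word. Qed.

Lemma tlift_linear : linear (tlift f).
Proof.
move=> c x y; rewrite -[x]lreprK -[y]lreprK -lpi_linear !tlift_pi.
exact: mlift_linear.
Qed.

End Lift.

Lemma tword_multilinear : multilinear (@tword K R).
Proof.
split=> [c a b w|h p c a b q]; rewrite tword.unlock -lpi_linear;
  apply/lpiE.
  exact: lspan_gen (MultHead c a b w).
exact: lspan_gen (MultTail h p c a b q).
Qed.

Lemma malg_word_sum (g : {malg K[nword]}) :
  g = \sum_(w <- msupp g) g@_w *: word1 w.
Proof.
rewrite {1}[g]monalgE; apply: eq_bigr => w _; apply/malgP => v.
by rewrite mcoeffZ !mcoeffU mulrnAr mulr1.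
Qed.

Lemma tbar_ind (P : tbar -> Prop) :
  P 0 -> (forall c x y, P x -> P y -> P (c *: x + y)) ->
  (forall w, P (tword w)) -> forall x, P x.
Proof.
move=> P0 Pl Pw x; rewrite -[x]lreprK; move: (lrepr x) => {x} g.
rewrite [g]malg_word_sum; elim/big_rec: _ => [|w u _ Pu].
  by rewrite (lin0 (@lpi_linear _ _ _)).
rewrite lpi_linear; apply: Pl => //.
by have := Pw w; rewrite tword.unlock.
Qed.

Lemma tbar_ext (V : lmodType K) (f g : tbar -> V) : linear f -> linear g ->
  (forall w, f (tword w) = g (tword w)) -> f =1 g.
Proof.
move=> fl gl fg; elim/tbar_ind=> // [|c x y fx fy]; first by rewrite !lin0.
by rewrite fl gl fx fy.
Qed.

Definition tens : Type := (K * tbar)%type.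
HB.instance Definition _ := GRing.Lmodule.copy tens (K^o * tbar)%type.

Lemma tens_linE c (x y : tens) :
  c *: x + y = (c * x.1 + y.1, c *: x.2 + y.2) :> tens.
Proof. by []. Qed.

Definition tens_word (s : seq R) : tens :=
  if s is a :: w then (0, tword (a, w)) else (1, 0).

End TensorTheory.
Arguments tword_multilinear {K R}.

(* Concatenation a x = a (x) x, for a in R and x in T(R). *)
HB.lock Definition tcons (K : fieldType) (R : lmodType K) (a : R) (x : tens R) :
    tbar R :=
  x.1 *: tword (a, [::]) + tlift (fun w => tword (a, w.1 :: w.2)) x.2.

Arguments tcons {K R} a x.

Section TconsTheory.
Variables (K : fieldType) (R : lmodType K).
Local Notation nword := (nword R).
Local Notation tbar := (tbar R).
Local Notation tens := (tens R).
Local Notation tword := (@tword K R).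

Lemma consw_multilinear a : multilinear (fun w : nword => tword (a, w.1 :: w.2)).
Proof.
split=> [c b b' w|h p c b b' q] /=; first exact: (tword_multilinear.2 a [::]).
exact: (tword_multilinear.2 a (h :: p)).
Qed.

Lemma tcons_linear (a : R) : linear (tcons a).
Proof.
move=> c x y; rewrite tens_linE unlock /=.
rewrite (tlift_linear (consw_multilinear a)).
by rewrite scalerDl -scalerA scalerDr addrACA.
Qed.

Lemma tcons_word (a : R) s : tcons a (tens_word s) = tword (a, s).
Proof.
case: s => [|b w]; rewrite unlock /=.
  by rewrite scale1r (lin0 (tlift_linear (consw_multilinear a))) addr0.
by rewrite scale0r add0r (tlift_word (consw_multilinear a)).
Qed.

Lemma tens_ext (V : lmodType K) (f g : tens -> V) : linear f -> linear g ->
  (forall s, f (tens_word s) = g (tens_word s)) -> f =1 g.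
Proof.
move=> fl gl fg [c x].
have -> : (c, x) = c *: tens_word [::] + ((0, x) : tens).
  by congr (_, _); rewrite /= ?scaler0 ?add0r // addr0 /GRing.scale /= mulr1.
have il : linear (fun x : tbar => (0, x) : tens).
  by move=> d u v; congr (_, _); rewrite /= scaler0 addr0.
rewrite fl gl fg; congr (_ + _); move: x.
apply: tbar_ext => [||[a w]]; [exact: (lin_comp fl il)|exact: (lin_comp gl il)|].
exact: (fg (a :: w)).
Qed.

Lemma tcons_linearl (x : tens) : linear (tcons^~ x).
Proof.
move=> c a b; have sl := lin_comb c (tcons_linear a) (tcons_linear b).
apply: (tens_ext (tcons_linear _) sl) => s; rewrite !tcons_word.
exact: (tword_multilinear.1).
Qed.

End TconsTheory.

Section QuasiShuffle.
Variables (K : fieldType) (R : nuComAlgType K).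
Let T := tens R.
Local Notation tword := (@tword K R).

(* ax * by = a (x * by) + b (ax * y) + (a . b) (x * y), the three terms being *)
(* ax < by, ax > by and ax . by. Since R is commutative, s > t = t < s, so    *)
(* that > is not named below.                                                 *)
Fixpoint wstar (u : seq R) : seq R -> T :=
  if u is a :: x then
    fix wstar_u (v : seq R) : T :=
      if v is b :: y then
        (0, tcons a (wstar x v) + tcons b (wstar_u y)
            + tcons (rmul a b) (wstar x y))
      else tens_word u
  else fun v => tens_word v.

(* ax < by = a (x * by) and ax . by = (a . b) (x * y), for words x and y;     *)
(* [qprec_cons] and [qdot_cons] give these formulas for x and y in T(R).      *)
Definition wprec (u v : nword R) : tbar R :=
  tcons u.1 (wstar u.2 (v.1 :: v.2)).
Definition wdot (u v : nword R) : tbar R :=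
  tcons (rmul u.1 v.1) (wstar u.2 v.2).

End QuasiShuffle.

HB.lock Definition qprec (K : fieldType) (R : nuComAlgType K) (s t : tbar R) :
    tbar R := tlift (fun u => tlift (fun v => wprec u v) t) s.
HB.lock Definition qdot (K : fieldType) (R : nuComAlgType K) (s t : tbar R) :
    tbar R := tlift (fun u => tlift (fun v => wdot u v) t) s.

Section QuasiShuffleTheory.
Variables (K : fieldType) (R : nuComAlgType K).
Let T := tens R.
Local Notation tword := (@tword K R).
Local Notation wstar := (@wstar K R).
Local Notation wprec := (@wprec K R).
Local Notation wdot := (@wdot K R).
Local Notation qprec := (@qprec K R).
Local Notation qdot := (@qdot K R).
Implicit Types a b : R.

Lemma wstar_cons a x b y : wstar (a :: x) (b :: y) =
  (0, tcons a (wstar x (b :: y)) + tcons b (wstar (a :: x) y)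
      + tcons (rmul a b) (wstar x y)).
Proof. by []. Qed.

Lemma wstars0 u : wstar u [::] = tens_word u. Proof. by case: u. Qed.

Lemma wstarC u v : wstar u v = wstar v u.
Proof.
elim: u v => [|a x IHx] v; first by rewrite wstars0.
elim: v => [//|b y IHy].
rewrite (wstar_cons a x b y) (wstar_cons b y a x).
rewrite (IHx (b :: y)) IHy (IHx y) (rmulC a b).
congr pair.
congr (_ + _).
exact: addrC.
Qed.

Lemma rmul_linearl (b : R) : linear (rmul^~ b : R -> R).
Proof. exact: (@rmul_bilinear _ R).1. Qed.

Lemma pair0_linear c (x y : tbar R) :
  ((0, c *: x + y) : T) = c *: ((0, x) : T) + ((0, y) : T).
Proof. by congr (_, _); rewrite /= scaler0 addr0. Qed.

Lemma wstar_linear p c a b q v : wstar (p ++ (c *: a + b) :: q) v =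
  c *: wstar (p ++ a :: q) v + wstar (p ++ b :: q) v.
Proof.
have cl := @tcons_linear K R; have cl' := @tcons_linearl K R.
elim: p v => [|h p IHp] v; elim: v => [|b' y IHy].
- by rewrite !wstars0 /= tword_multilinear.1 pair0_linear.
- rewrite !cat0s in IHy *; rewrite !wstar_cons IHy cl rmul_linearl !cl'.
  by rewrite scale_add3 pair0_linear.
- by rewrite !wstars0 /= tword_multilinear.2 pair0_linear.
- rewrite !cat_cons in IHy *; rewrite !wstar_cons IHy !IHp !cl.
  by rewrite scale_add3 pair0_linear.
Qed.

Lemma wstar_linearr u p c a b q : wstar u (p ++ (c *: a + b) :: q) =
  c *: wstar u (p ++ a :: q) + wstar u (p ++ b :: q).
Proof. by rewrite wstarC wstar_linear !(wstarC u). Qed.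

Lemma wprec_multilinear u : multilinear (wprec u).
Proof.
split=> [c a b w|h p c a b q]; rewrite /wprec /=.
  by rewrite (wstar_linearr _ [::]) tcons_linear.
by rewrite (wstar_linearr _ (h :: p)) tcons_linear.
Qed.

Lemma wprec_multilinearl v : multilinear (wprec^~ v).
Proof.
split=> [c a b w|h p c a b q]; rewrite /wprec /=; first by rewrite tcons_linearl.
by rewrite wstar_linear tcons_linear.
Qed.

Lemma wdotC u v : wdot u v = wdot v u.
Proof. by rewrite /wdot rmulC wstarC. Qed.

Lemma wdot_multilinearl v : multilinear (wdot^~ v).
Proof.
split=> [c a b w|h p c a b q]; rewrite /wdot /=.
  by rewrite rmul_linearl tcons_linearl.
by rewrite wstar_linear tcons_linear.
Qed.

Lemma wdot_multilinear u : multilinear (wdot u).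
Proof.
by split=> *; rewrite ![wdot u _]wdotC; apply wdot_multilinearl.
Qed.

Lemma tlift_multilinear (f : nword R -> nword R -> tbar R) :
  (forall u, multilinear (f u)) -> (forall v, multilinear (f^~ v)) ->
  forall t, multilinear (fun u => tlift (fun v => f u v) t).
Proof.
move=> fr fl t.
have cl (g h : nword R -> tbar R) c : multilinear g -> multilinear h ->
    linear (fun t => c *: tlift g t + tlift h t).
  by move=> gm hm; exact: lin_comb (tlift_linear gm) (tlift_linear hm).
split=> [c a b w|h p c a b q]; move: t; apply: tbar_ext => [||v].
- exact: tlift_linear (fr _).
- exact: cl.
- by rewrite !tlift_word // (fl v).1.
- exact: tlift_linear (fr _).
- exact: cl.
- by rewrite !tlift_word // (fl v).2.
Qed.

Lemma tlift2_bilinear (f : nword R -> nword R -> tbar R) :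
  (forall u, multilinear (f u)) -> (forall v, multilinear (f^~ v)) ->
  bilinear_for *:%R *:%R
    (fun s t : tbar R => tlift (fun u => tlift (fun v => f u v) t) s).
Proof.
move=> fr fl; have fm := tlift_multilinear fr fl.
split=> [t|s]; first exact: tlift_linear (fm t).
move=> c x y; move: s; apply: tbar_ext.
- exact: tlift_linear.
- exact: lin_comb (tlift_linear (fm x)) (tlift_linear (fm y)).
- by move=> w; rewrite !(tlift_word (fm _)) (tlift_linear (fr w)).
Qed.

Lemma qprec_bilinear : bilinear_for *:%R *:%R qprec.
Proof. rewrite unlock; exact: tlift2_bilinear wprec_multilinear wprec_multilinearl. Qed.
Lemma qdot_bilinear : bilinear_for *:%R *:%R qdot.
Proof. rewrite unlock; exact: tlift2_bilinear wdot_multilinear wdot_multilinearl. Qed.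

Lemma qprec_word u v : qprec (tword u) (tword v) = wprec u v.
Proof.
rewrite unlock tlift_word ?tlift_word //; first exact: wprec_multilinear.
exact: tlift_multilinear wprec_multilinear wprec_multilinearl _.
Qed.
Lemma qdot_word u v : qdot (tword u) (tword v) = wdot u v.
Proof.
rewrite unlock tlift_word ?tlift_word //; first exact: wdot_multilinear.
exact: tlift_multilinear wdot_multilinear wdot_multilinearl _.
Qed.

Definition qstar_bar (s t : tbar R) := qprec s t + qprec t s + qdot s t.
Definition qstar (x y : T) : T :=
  (x.1 * y.1, x.1 *: y.2 + y.1 *: x.2 + qstar_bar x.2 y.2).

Lemma qprecDl s t u : qprec (s + t) u = qprec s u + qprec t u.
Proof. exact: (linD s t (qprec_bilinear.1 u)). Qed.
Lemma qprecDr s t u : qprec s (t + u) = qprec s t + qprec s u.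
Proof. exact: (linD t u (qprec_bilinear.2 s)). Qed.
Lemma qdotDl s t u : qdot (s + t) u = qdot s u + qdot t u.
Proof. exact: (linD s t (qdot_bilinear.1 u)). Qed.
Lemma qdotDr s t u : qdot s (t + u) = qdot s t + qdot s u.
Proof. exact: (linD t u (qdot_bilinear.2 s)). Qed.
Lemma qprec0 s : qprec s 0 = 0.
Proof. exact: (lin0 (qprec_bilinear.2 s)). Qed.
Lemma q0prec s : qprec 0 s = 0.
Proof. exact: (lin0 (qprec_bilinear.1 s)). Qed.
Lemma qdot0 s : qdot s 0 = 0.
Proof. exact: (lin0 (qdot_bilinear.2 s)). Qed.

Lemma qdotC s t : qdot s t = qdot t s.
Proof.
move: s; apply: (tbar_ext (qdot_bilinear.1 t) (qdot_bilinear.2 t)) => u.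
move: t; apply: (tbar_ext (qdot_bilinear.2 _) (qdot_bilinear.1 _)) => v.
by rewrite !qdot_word wdotC.
Qed.

Lemma qstar_barC s t : qstar_bar s t = qstar_bar t s.
Proof. by rewrite /qstar_bar qdotC; congr (_ + _); exact: addrC. Qed.

Lemma qstarC x y : qstar x y = qstar y x.
Proof.
by rewrite /qstar mulrC qstar_barC; congr (_, _ + _); exact: addrC.
Qed.

Lemma qstar_bar3l s1 s2 s3 u : qstar_bar (s1 + s2 + s3) u =
  (qprec s1 u + qprec s2 u + qprec s3 u) + qprec u (s1 + s2 + s3)
  + (qdot u s1 + qdot u s2 + qdot s3 u).
Proof.
rewrite /qstar_bar (qprecDl (s1 + s2)) (qprecDl s1).
by rewrite (qdotDl (s1 + s2)) (qdotDl s1) (qdotC s1) (qdotC s2).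
Qed.

Lemma qstar_bar3r u s1 s2 s3 : qstar_bar u (s1 + s2 + s3) =
  qprec u (s1 + s2 + s3) + (qprec s1 u + qprec s2 u + qprec s3 u)
  + (qdot u s1 + qdot u s2 + qdot u s3).
Proof.
rewrite /qstar_bar (qprecDl (s1 + s2)) (qprecDl s1).
by rewrite (qdotDr u (s1 + s2)) (qdotDr u s1).
Qed.

Lemma qstar_bar_linear t : linear (qstar_bar^~ t).
Proof.
by apply: lin_add; [apply: lin_add|];
  [exact: qprec_bilinear.1 | exact: qprec_bilinear.2 | exact: qdot_bilinear.1].
Qed.

Lemma qstar_linearl y : linear (qstar^~ y).
Proof.
move=> c [d x] [e z]; rewrite !tens_linE /qstar /=; congr (_, _).
  by rewrite mulrDl -mulrA.
rewrite qstar_bar_linear scalerDl -scalerA scalerDr.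
by rewrite (scalerA _ c) (mulrC _ c) -(scalerA c) scale_add3.
Qed.

Lemma qstar_linearr x : linear (qstar x).
Proof. by move=> c y z; rewrite ![qstar x _]qstarC qstar_linearl. Qed.

Lemma qstar1 x : qstar (tens_word [::]) x = x.
Proof.
case: x => c x; congr (_, _) => /=; first by rewrite mul1r.
rewrite scale1r scaler0 addr0 qstar_barC /qstar_bar.
by rewrite qprec0 q0prec qdot0 !addr0.
Qed.

Lemma qstar_word u v : qstar (tens_word u) (tens_word v) = wstar u v.
Proof.
case: u v => [|a x] [|b y]; rewrite ?qstar1 ?wstars0 //.
  by rewrite qstarC qstar1.
rewrite wstar_cons /qstar /= mulr0 !scale0r !add0r; congr (_, _).
by rewrite /qstar_bar !qprec_word qdot_word /wprec /wdot /= (wstarC y).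
Qed.

Lemma qprec_cons a x b y :
  qprec (tcons a x) (tcons b y) = tcons a (qstar x (0, tcons b y)).
Proof.
have il : linear (fun x : tbar R => (0, x) : T) by move=> *; exact: pair0_linear.
move: x; apply: tens_ext => [||u].
- exact: (lin_comp (qprec_bilinear.1 _) (@tcons_linear _ _ a)).
- exact: (lin_comp (@tcons_linear _ _ a) (qstar_linearl _)).
move: y; apply: tens_ext => [||v].
- exact: (lin_comp (qprec_bilinear.2 _) (@tcons_linear _ _ b)).
- apply: (lin_comp (@tcons_linear _ _ a)).
  apply: (lin_comp (qstar_linearr _)).
  exact: (lin_comp il (@tcons_linear _ _ b)).
by rewrite !tcons_word qprec_word /wprec /= (qstar_word u (b :: v)).
Qed.

Lemma qdot_cons a x b y :
  qdot (tcons a x) (tcons b y) = tcons (rmul a b) (qstar x y).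
Proof.
move: x; apply: tens_ext => [||u].
- exact: (lin_comp (qdot_bilinear.1 _) (@tcons_linear _ _ a)).
- exact: (lin_comp (@tcons_linear _ _ _) (qstar_linearl _)).
move: y; apply: tens_ext => [||v].
- exact: (lin_comp (qdot_bilinear.2 _) (@tcons_linear _ _ b)).
- exact: (lin_comp (@tcons_linear _ _ _) (qstar_linearr _)).
by rewrite !tcons_word qdot_word /wdot qstar_word.
Qed.

Lemma qprec_consr a x t : qprec (tcons a x) t = tcons a (qstar x (0, t)).
Proof.
have il : linear (fun x : tbar R => (0, x) : T) by move=> *; exact: pair0_linear.
move: t; apply: tbar_ext => [||[b v]].
- exact: (qprec_bilinear.2 _).
- apply: (lin_comp (@tcons_linear _ _ a)).
  exact: (lin_comp (qstar_linearr _) il).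
by rewrite -tcons_word qprec_cons.
Qed.

Lemma qstar_bar0 s t : qstar ((0, s) : T) ((0, t) : T) = (0, qstar_bar s t).
Proof. by rewrite /qstar /= mulr0 !scale0r !add0r. Qed.

Lemma qstar_bar_assoc s t u :
  qprec (qprec s t) u = qprec s (qstar_bar t u) ->
  qprec (qprec t s) u = qprec t (qstar_bar s u) ->
  qprec (qprec t u) s = qprec t (qstar_bar u s) ->
  qprec (qprec u t) s = qprec u (qstar_bar t s) ->
  qprec (qdot s t) u = qdot s (qprec t u) ->
  qprec (qdot u s) t = qdot u (qprec s t) ->
  qprec (qdot s u) t = qdot s (qprec u t) ->
  qprec (qdot u t) s = qdot u (qprec t s) ->
  qdot (qdot s t) u = qdot s (qdot t u) ->
  qstar_bar (qstar_bar s t) u = qstar_bar s (qstar_bar t u).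
Proof.
rewrite (qdotC u s) (qdotC u t) (qstar_barC u s) (qstar_barC t s).
move=> P1 P2 P3 P4 D1 D2 D3 D4 A.
rewrite [LHS]qstar_bar3l [RHS]qstar_bar3r -/(qstar_bar s t) -/(qstar_bar t u).
rewrite P1 P2 P3 P4 D1 A D4 -D2 -D3.
exact: add7_perm.
Qed.

Lemma qstar_assoc_words p q r :
  qstar (qstar (tens_word p) (tens_word q)) (tens_word r) =
  qstar (tens_word p) (qstar (tens_word q) (tens_word r)).
Proof.
have [n] := ubnP (size p + size q + size r)%N; elim: n p q r => // n IH p q r.
case: p => [|a x]; first by rewrite !qstar1.
case: q => [|b y]; first by rewrite qstar1 (qstarC (tens_word _)) qstar1.
case: r => [|c z].
  rewrite (qstarC (qstar _ _) (tens_word [::])).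
  by rewrite (qstarC (tens_word (b :: y)) (tens_word [::])) !qstar1.
rewrite /= !addSn !addnS ltnS => szn.
have P a1 x1 b1 y1 c1 z1 : ((size x1 + size y1 + size z1).+2 < n)%N ->
    qprec (qprec (tword (a1, x1)) (tword (b1, y1))) (tword (c1, z1)) =
    qprec (tword (a1, x1)) (qstar_bar (tword (b1, y1)) (tword (c1, z1))).
  move=> sz; rewrite -(tcons_word a1) !qprec_consr; congr tcons.
  rewrite -qstar_bar0; apply: (IH x1 (b1 :: y1) (c1 :: z1)).
  by rewrite /= !addnS addSn.
have D a1 x1 b1 y1 c1 z1 : ((size x1 + size y1 + size z1).+2 < n)%N ->
    qprec (qdot (tword (a1, x1)) (tword (b1, y1))) (tword (c1, z1)) =
    qdot (tword (a1, x1)) (qprec (tword (b1, y1)) (tword (c1, z1))).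
  move=> sz; rewrite -(tcons_word a1) -(tcons_word b1).
  rewrite qdot_cons !qprec_consr qdot_cons; congr tcons.
  apply: (IH x1 y1 (c1 :: z1)).
  by rewrite /= addnS; exact: ltnW.
rewrite /= !qstar_bar0; congr (_, _).
have sz1 : ((size y + size x + size z).+2 < n)%N by rewrite (addnC (size y)).
have sz2 : ((size y + size z + size x).+2 < n)%N by rewrite addnC addnA.
have sz3 : ((size z + size y + size x).+2 < n)%N by rewrite (addnC (size z)).
have sz4 : ((size z + size x + size y).+2 < n)%N by rewrite -addnA addnC.
have sz5 : ((size x + size z + size y).+2 < n)%N by rewrite addnAC.
apply: qstar_bar_assoc; try exact: P; try exact: D.
rewrite -!tcons_word !qdot_cons rmulA; congr tcons.
by apply: IH; exact: ltnW (ltnW szn).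
Qed.

Lemma qstar_assoc (x y z : T) : qstar (qstar x y) z = qstar x (qstar y z).
Proof.
have ll v : linear (qstar^~ v) := qstar_linearl v.
move: x; apply: tens_ext => [||p].
- exact: (lin_comp (ll z) (ll y)).
- exact: ll.
move: y; apply: tens_ext => [||q].
- exact: (lin_comp (ll z) (qstar_linearr _)).
- exact: (lin_comp (qstar_linearr _) (ll z)).
move: z; apply: tens_ext => [||r].
- exact: qstar_linearr.
- exact: (lin_comp (qstar_linearr _) (qstar_linearr _)).
exact: qstar_assoc_words.
Qed.

Lemma qprecA s t u :
  qprec (qprec s t) u = qprec s (qprec t u + qprec u t + qdot t u).
Proof.
move: s; apply: tbar_ext => [||[a x]].
- exact: (lin_comp (qprec_bilinear.1 _) (qprec_bilinear.1 _)).
- exact: qprec_bilinear.1.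
by rewrite -tcons_word !qprec_consr qstar_assoc qstar_bar0.
Qed.

Lemma qdot_prec s t u : qprec (qdot s t) u = qdot s (qprec t u).
Proof.
move: s; apply: tbar_ext => [||[a x]].
- exact: (lin_comp (qprec_bilinear.1 _) (qdot_bilinear.1 _)).
- exact: qdot_bilinear.1.
move: t; apply: tbar_ext => [||[b y]].
- exact: (lin_comp (qprec_bilinear.1 _) (qdot_bilinear.2 _)).
- exact: (lin_comp (qdot_bilinear.2 _) (qprec_bilinear.1 _)).
by rewrite -!tcons_word qdot_cons !qprec_consr qdot_cons qstar_assoc.
Qed.

Lemma qdotA s t u : qdot (qdot s t) u = qdot s (qdot t u).
Proof.
move: s; apply: tbar_ext => [||[a x]].
- exact: (lin_comp (qdot_bilinear.1 _) (qdot_bilinear.1 _)).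
- exact: qdot_bilinear.1.
move: t; apply: tbar_ext => [||[b y]].
- exact: (lin_comp (qdot_bilinear.1 _) (qdot_bilinear.2 _)).
- exact: (lin_comp (qdot_bilinear.2 _) (qdot_bilinear.1 _)).
move: u; apply: tbar_ext => [||[c z]].
- exact: qdot_bilinear.2.
- exact: (lin_comp (qdot_bilinear.2 _) (qdot_bilinear.2 _)).
by rewrite -!tcons_word !qdot_cons qstar_assoc rmulA.
Qed.

(* T^q(R) is [unital qshuffle]. *)
Definition qshuffle : Type := tbar R.
HB.instance Definition _ := GRing.Lmodule.on qshuffle.
HB.instance Definition _ := Lmodule_isCTD.Build K qshuffle
  qprec_bilinear qdot_bilinear qdotC qprecA qdot_prec qdotA.

Lemma ustar_qshuffle (x y : unital qshuffle) : ustar x y = qstar x y.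
Proof. by []. Qed.

End QuasiShuffleTheory.

(* Main.v *)
Require Import Defs.
From mathcomp Require Import all_boot all_order all_algebra.

Set Implicit Arguments.
Unset Strict Implicit.
Unset Printing Implicit Defensive.

Import GRing.Theory.
Local Open Scope ring_scope.

(** The quasi-shuffle algebra has the universal property that defines
    [U_CTD(R)]: every morphism of commutative algebras [f] from [R] to the dot
    algebra of a CTD-algebra [A] extends uniquely along the letters [R -> T^q(R)]
    to a morphism of unital CTD-algebras ([qshuffle_universal]). Two objects with
    the same universal property are isomorphic, since the two extensions of the
    units are inverse to each other by uniqueness.

    Uniqueness: the letters generate, because a word of length at least 2 is
    [a w = a < w]. The same identity forces the extension to be
    [F(a w) = f a < F w] with [F 1 = 1], that is
    [a_1 ... a_n |-> f a_1 < (f a_2 < (... < f a_n))], and this is multilinear.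

    Existence: in every CTD-algebra the axioms imply, for [a], [b] in the
    augmentation ideal and arbitrary [X], [Y],
    [(a < X) < Y = a < (X * Y)] and [(a < X) . (b < Y) = (a . b) < (X * Y)]
    ([uprecr_ustar], [dot_uprecr]). These are the recursive rules for [<] and [.]
    on words, with [f a . f b = f (a b)], so that [F] preserves [*] on words by
    induction on their total length ([word_map_wstar]), and then [<] and [.]. *)

(** * The axioms of a CTD-algebra in the presence of the unit *)

Section UnitalAction.
Variables (K : fieldType) (A : ctdType K).
Implicit Types (a b : A) (X Y : unital A).

(** The product [a < X] for [a] in the augmentation ideal and [X] arbitrary.
    It lies in the augmentation ideal, so it is given as an element of [A]. *)
Definition uprecr a X : A := X.1 *: a + prec a X.2.

Lemma uprecr_linear a : linear (uprecr a).
Proof.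
move=> c X Y; rewrite /uprecr /= ((@prec_bilinear _ A).2 a).
by rewrite scalerDl -scalerA scalerDr addrACA.
Qed.

Lemma uprecr_linearl X : linear (uprecr^~ X).
Proof.
move=> c a b; rewrite /uprecr ((@prec_bilinear _ A).1 X.2) !scalerDr !scalerA.
by rewrite (mulrC X.1) addrACA.
Qed.

Lemma uprecr_one a : uprecr a uone = a.
Proof. by rewrite /uprecr /= scale1r (lin0 ((@prec_bilinear _ A).2 a)) addr0. Qed.

Lemma uprecr_aug a b : uprecr a (aug_incl b) = prec a b.
Proof. by rewrite /uprecr /= scale0r add0r. Qed.

Lemma uprecr_ustar a X Y : uprecr (uprecr a X) Y = uprecr a (ustar X Y).
Proof.
rewrite /uprecr /ustar /=.
rewrite !(linD _ _ ((@prec_bilinear _ A).1 _)) (linZ _ _ ((@prec_bilinear _ A).1 _)).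
rewrite precA (linD (_ *: _ + _) _ ((@prec_bilinear _ A).2 a)).
rewrite (linD (_ *: _) _ ((@prec_bilinear _ A).2 a)).
rewrite !(linZ _ _ ((@prec_bilinear _ A).2 a)) scalerDr scalerA (mulrC Y.1).
by rewrite -!addrA (addrCA (Y.1 *: _)).
Qed.

Lemma dot_uprecrr a b X : dot a (uprecr b X) = uprecr (dot a b) X.
Proof.
rewrite /uprecr (linD _ _ ((@dot_bilinear _ A).2 a)).
by rewrite (linZ _ _ ((@dot_bilinear _ A).2 a)) dot_prec.
Qed.

(** Pull [Y] out of the right factor, then [X] out of the left one by
    commutativity, and merge the two by [uprecr_ustar]. *)
Lemma dot_uprecr a b X Y :
  dot (uprecr a X) (uprecr b Y) = uprecr (dot a b) (ustar X Y).
Proof. by rewrite dot_uprecrr dotC dot_uprecrr uprecr_ustar dotC. Qed.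

End UnitalAction.

Section UnitalMorphisms.
Variable K : fieldType.

Lemma unital_morphism_id (A : ctdType K) : unital_morphism (@id (unital A)).
Proof. by split. Qed.

Lemma unital_morphism_comp (A B C : ctdType K)
    (g : unital B -> unital C) (f : unital A -> unital B) :
  unital_morphism g -> unital_morphism f -> unital_morphism (g \o f).
Proof.
move=> [gl g1 ga gp gd] [fl f1 fa fp fd]; split=> /=.
- exact: lin_comp gl fl.
- by rewrite f1 g1.
- by move=> x /fa/ga.
- by move=> x y xy; rewrite fp // gp //; case: xy => /fa; [left | right].
- by move=> x y xy; rewrite fd // gd //; case: xy => /fa; [left | right].
Qed.

End UnitalMorphisms.

(** * The extension to words of a morphism defined on letters *)

Section Extension.
Variables (K : fieldType) (R : nuComAlgType K) (A : ctdType K).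
Variable f : R -> forget A.
Hypothesis fm : nucomalg_morphism f.

Let fl : linear (f : R -> A). Proof. exact: fm.1. Qed.

Fixpoint word_map (s : seq R) : unital A :=
  if s is a :: w then aug_incl (uprecr (f a : A) (word_map w)) else uone.

Definition nword_map (w : nword R) : A := uprecr (f w.1 : A) (word_map w.2).

Lemma word_map_linear p c a b q :
  word_map (p ++ (c *: a + b) :: q) =
  c *: word_map (p ++ a :: q) + word_map (p ++ b :: q).
Proof.
elim: p => [|h p IHp] /=; rewrite -aug_incl_linear; congr aug_incl.
  by rewrite fl uprecr_linearl.
by rewrite IHp uprecr_linear.
Qed.

Lemma nword_map_multilinear : multilinear nword_map.
Proof.
split=> [c a b w|h p c a b q]; rewrite /nword_map /=.
  by rewrite fl uprecr_linearl.
by rewrite word_map_linear uprecr_linear.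
Qed.

Definition tbar_map : tbar R -> A := tlift nword_map.

Lemma tbar_map_linear : linear tbar_map.
Proof. exact: tlift_linear nword_map_multilinear. Qed.

Definition tens_map (x : tens R) : unital A := (x.1, tbar_map x.2).

Lemma tens_map_linear : linear tens_map.
Proof. by move=> c x y; congr (_, _); rewrite /= tbar_map_linear. Qed.

Lemma tbar_map_word w : tbar_map (tword w) = nword_map w.
Proof. exact: tlift_word nword_map_multilinear w. Qed.

Lemma tens_map_word s : tens_map (tens_word s) = word_map s.
Proof.
case: s => [|a w]; congr (_, _); first exact: lin0 tbar_map_linear.
exact: tbar_map_word.
Qed.

Lemma tbar_map_tcons a x : tbar_map (tcons a x) = uprecr (f a : A) (tens_map x).
Proof.
move: x; apply: tens_ext => [||s].
- exact: lin_comp tbar_map_linear (@tcons_linear _ _ a).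
- exact: lin_comp (uprecr_linear (f a : A)) tens_map_linear.
by rewrite tcons_word tbar_map_word tens_map_word.
Qed.

(** The three summands of the recursion for [wstar] are the images of the
    three summands [X < Y], [Y < X] and [X . Y] of [X * Y]. *)
Lemma word_map_wstar u v :
  tens_map (wstar u v) = ustar (word_map u) (word_map v).
Proof.
elim: u v => [|a x IHx] v; first by rewrite tens_map_word ustar1x.
elim: v => [|b y IHy]; first by rewrite wstars0 tens_map_word ustarC ustar1x.
rewrite wstar_cons ustar_aug // /uprec /udot /tens_map; congr (_, _).
  by rewrite /= !addr0.
rewrite [LHS](linD _ _ tbar_map_linear) (linD (tcons _ _) _ tbar_map_linear).
rewrite !tbar_map_tcons IHx IHy IHx fm.2.
rewrite (ustarC (word_map (a :: x))) -dot_uprecr -!uprecr_ustar !uprecr_aug /=.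
by rewrite !scale0r !add0r.
Qed.

Lemma tbar_map_prec s t : tbar_map (qprec s t) = prec (tbar_map s) (tbar_map t).
Proof.
move: s; apply: tbar_ext => [||u].
- exact: lin_comp tbar_map_linear ((@qprec_bilinear _ R).1 t).
- exact: lin_comp ((@prec_bilinear _ A).1 _) tbar_map_linear.
move: t; apply: tbar_ext => [||v].
- exact: lin_comp tbar_map_linear ((@qprec_bilinear _ R).2 _).
- exact: lin_comp ((@prec_bilinear _ A).2 _) tbar_map_linear.
rewrite qprec_word tbar_map_tcons word_map_wstar -uprecr_ustar uprecr_aug.
by rewrite !tbar_map_word.
Qed.

Lemma tbar_map_dot s t : tbar_map (qdot s t) = dot (tbar_map s) (tbar_map t).
Proof.
move: s; apply: tbar_ext => [||u].
- exact: lin_comp tbar_map_linear ((@qdot_bilinear _ R).1 t).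
- exact: lin_comp ((@dot_bilinear _ A).1 _) tbar_map_linear.
move: t; apply: tbar_ext => [||v].
- exact: lin_comp tbar_map_linear ((@qdot_bilinear _ R).2 _).
- exact: lin_comp ((@dot_bilinear _ A).2 _) tbar_map_linear.
by rewrite qdot_word tbar_map_tcons word_map_wstar fm.2 -dot_uprecr !tbar_map_word.
Qed.

Lemma tbar_map_morphism : ctd_morphism (tbar_map : qshuffle R -> A).
Proof. split; [exact: tbar_map_linear|exact: tbar_map_prec|exact: tbar_map_dot]. Qed.

End Extension.

(** * The universal property of the quasi-shuffle algebra *)

Definition letter (K : fieldType) (R : nuComAlgType K) (a : R) :
    forget (qshuffle R) := tword (a, [::]).

Section Universal.
Variables (K : fieldType) (R : nuComAlgType K).

Lemma letter_morphism : nucomalg_morphism (@letter K R).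
Proof.
split=> [c a b|a b]; first exact: tword_multilinear.1.
apply/esym; rewrite [LHS](qdot_word (a, [::]) (b, [::])) /wdot.
by rewrite (tcons_word _ [::]).
Qed.

(** The letters generate: peel off the first letter of a word by
    [a w = a < w]. *)
Lemma qshuffle_morph_ext (A : ctdType K) (g h : qshuffle R -> A) :
  ctd_morphism g -> ctd_morphism h ->
  (forall a, g (letter a) = h (letter a)) -> g =1 h.
Proof.
move=> [gl gp _] [hl hp _] gh; apply: tbar_ext => // -[a w].
elim: w a => [|b w IHw] a; first exact: gh.
have -> : tword (a, b :: w) = prec (letter a : qshuffle R) (tword (b, w)).
  apply/esym; rewrite [LHS](qprec_word (a, [::]) (b, w)) /wprec.
  by rewrite (tcons_word _ (b :: w)).
by rewrite gp hp gh IHw.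
Qed.

Theorem qshuffle_universal (A : ctdType K) (f : R -> forget A) :
  nucomalg_morphism f ->
  exists F : unital (qshuffle R) -> unital A,
    [/\ unital_morphism F, forall a, F (aug_incl (letter a)) = aug_incl (f a)
      & forall G, unital_morphism G ->
          (forall a, G (aug_incl (letter a)) = aug_incl (f a)) -> G =1 F].
Proof.
move=> fm; have Fm := tbar_map_morphism fm.
have Fa a : tbar_map f (letter a) = f a.
  by rewrite (tbar_map_word fm) /nword_map /= uprecr_one.
exists (fun x => (x.1, tbar_map f x.2)); split.
- exact: unital_morphism_ext.
- by move=> a; congr (_, _); exact: Fa.
move=> G Gm Gf x; have [gm ->] := unital_morphism_restr Gm; congr (_, _).
by apply: (qshuffle_morph_ext gm Fm) => a; rewrite Gf Fa.
Qed.

End Universal.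

Theorem theorem2p7 (K : fieldType) (R : nuComAlgType K) :
  exists (f : unital (env_ctd R) -> unital (qshuffle R))
         (g : unital (qshuffle R) -> unital (env_ctd R)),
    [/\ unital_morphism f, unital_morphism g, cancel f g & cancel g f].
Proof.
have [f [fm fu _]] := env_ctd_universal (letter_morphism R).
have [g [gm gl _]] := qshuffle_universal (env_unit_morphism R).
have [e [_ _ eU]] := env_ctd_universal (env_unit_morphism R).
have [q [_ _ qU]] := qshuffle_universal (letter_morphism R).
exists f, g; split=> // x.
  rewrite [RHS](eU id (unital_morphism_id _)) //.
  by apply: (eU (g \o f)); [exact: unital_morphism_comp | move=> a /=; rewrite fu].
rewrite [RHS](qU id (unital_morphism_id _)) //.
by apply: (qU (f \o g)); [exact: unital_morphism_comp | move=> a /=; rewrite gl].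
Qed.
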